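(* Let $\xi=(\xi(\theta),\theta\in\mathcal T)$ and $\zeta=(\zeta(\theta),\theta\in\mathcal T)$ be two admissible families such that $E[\operatorname{ess\,sup}_{\theta\in\mathcal T}(\xi(\theta))^-]<+\infty$, $E[\operatorname{ess\,sup}_{\theta\in\mathcal T}(\zeta(\theta))^+]<+\infty$, and $\xi(T)=\zeta(T)=0$ a.s. Let $J$ and $J'$ be the families associated with $\xi,\zeta$ as defined in the context. Then $J$ and $J'$ are nonnegative supermartingale families which satisfy $J=\mathcal R(J'+\xi)$ and $J'=\mathcal R(J-\zeta)$, that is, for each $\theta\in\mathcal T$, $$J(\theta)=\operatorname*{ess\,sup}_{\tau\in\mathcal T_\theta}E[J'(\tau)+\xi(\tau)\mid\mathcal F_\theta]\ \text{a.s.},\qquad J'(\theta)=\operatorname*{ess\,sup}_{\sigma\in\mathcal T_\theta}E[J(\sigma)-\zeta(\sigma)\mid\mathcal F_\theta]\ \text{a.s.}$$ Moreover, $J$ and $J'$ are minimal in the following sense: if $H$ and $H'$ are two nonnegative supermartingale families such that $H\ge H'+\xi$ and $H'\ge H-\zeta$, then $J\le H$ and $J'\le H'$.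
   Context: Let $(\Omega,\mathcal F,(\mathcal F_t)_{0\le t\le T},P)$ be a filtered probability space satisfying the usual conditions (right-continuity and completeness), with $\mathcal F=\mathcal F_T$, $\mathcal F_0$ containing only sets of probability $0$ or $1$, and a fixed horizon $T\in(0,\infty)$. $\mathcal T$ is the set of stopping times with values in $[0,T]$; for a stopping time $S$, $\mathcal T_S=\{\theta\in\mathcal T:\theta\ge S\text{ a.s.}\}$. A family $\phi=(\phi(\theta),\theta\in\mathcal T)$ of $\overline{\mathbb R}$-valued random variables is admissible if each $\phi(\theta)$ is $\mathcal F_\theta$-measurable and $\phi(\theta)=\phi(\theta')$ a.s. on $\{\theta=\theta'\}$ for all $\theta,\theta'\in\mathcal T$. For families, $\phi\ge\phi'$ means $\phi(\theta)\ge\phi'(\theta)$ a.s. for each $\theta\in\mathcal T$ (similarly $\le$, $=$). An admissible family $\phi$ with $E[\operatorname{ess\,sup}_{\theta\in\mathcal T}\phi(\theta)^-]<\infty$ is a supermartingale family if $E[\phi(\theta)\mid\mathcal F_{\theta'}]\le\phi(\theta')$ a.s. for all $\theta,\theta'\in\mathcal T$ with $\theta\ge\theta'$ a.s. For such an admissible $\phi$, the Snell envelope $\mathcal R(\phi)$ is the family $\mathcal R(\phi)(S)=\operatorname{ess\,sup}_{\theta\in\mathcal T_S}E[\phi(\theta)\mid\mathcal F_S]$, $S\in\mathcal T$. The families $J,J'$: set $J_0(\theta)=J'_0(\theta)=0$ and for $n\ge0$, $J_{n+1}(\theta)=\operatorname{ess\,sup}_{\tau\in\mathcal T_\theta}E[J'_n(\tau)+\xi(\tau)\mid\mathcal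 F_\theta]$, $J'_{n+1}(\theta)=\operatorname{ess\,sup}_{\sigma\in\mathcal T_\theta}E[J_n(\sigma)-\zeta(\sigma)\mid\mathcal F_\theta]$; then $J(\theta)=\limsup_{n\to\infty}J_n(\theta)$ and $J'(\theta)=\limsup_{n\to\infty}J'_n(\theta)$. *)

(* Defs.v *)
From mathcomp Require Import all_boot all_order all_algebra.
From mathcomp Require Import all_classical all_reals all_analysis.
From mathcomp Require Import measurable_realfun.
Set Implicit Arguments. Unset Strict Implicit. Unset Printing Implicit Defensive.
Import Order.TTheory GRing.Theory Num.Theory.
Local Open Scope classical_set_scope.
Local Open Scope ring_scope.

Section defs.
Context {R : realType} {d : measure_display} {Omega : measurableType d}.
Variable (P : probability Omega R).
Variables (T : R) (F : R -> set (set Omega)).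

(* families of random variables indexed by stopping times (functions Omega -> R) *)
Definition sfamily := (Omega -> R) -> Omega -> \bar R.

Definition meas_wrt (G : set (set Omega)) (X : Omega -> \bar R) : Prop :=
  forall B : set (\bar R), measurable B -> G (X @^-1` B).

Definition is_cond_exp (G : set (set Omega)) (X Y : Omega -> \bar R) : Prop :=
  [/\ meas_wrt G Y,
      (\int[P]_x (Y^\- x) < +oo)%E &
      forall A, G A -> (\int[P]_(x in A) Y x = \int[P]_(x in A) X x)%E].

Definition is_ess_sup (I : set (Omega -> R)) (X : sfamily) (Y : Omega -> \bar R)
  : Prop :=
  [/\ measurable_fun setT Y,
      (forall i, I i -> {ae P, forall x, (X i x <= Y x)%E}) &
      (forall Z : Omega -> \bar R, measurable_fun setT Z ->
         (forall i, I i -> {ae P, forall x, (X i x <= Z x)%E}) ->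
         {ae P, forall x, (Y x <= Z x)%E})].

Definition is_esssup_condexp (G : set (set Omega)) (I : set (Omega -> R))
  (Z : sfamily) (Y : Omega -> \bar R) : Prop :=
  exists X : sfamily, (forall i, I i -> is_cond_exp G (Z i) (X i)) /\
                     is_ess_sup I X Y.

Definition usual_filtration : Prop :=
  [/\ (forall t, 0 <= t <= T -> sigma_algebra setT (F t) /\ F t `<=` measurable),
      (forall s t, 0 <= s -> s <= t -> t <= T -> F s `<=` F t),
      (forall t, 0 <= t < T -> F t = [set A | forall u, t < u <= T -> F u A]),
      (forall N, measurable N -> P N = 0%E -> forall A, A `<=` N -> F 0 A) &
      (F T = measurable /\ (forall A, F 0 A -> P A = 0%E \/ P A = 1%E))].

Definition is_stopping (theta : Omega -> R) : Prop :=
  (forall x, 0 <= theta x <= T) /\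
  (forall t, 0 <= t <= T -> F t [set x | theta x <= t]).

Definition F_at (theta : Omega -> R) : set (set Omega) :=
  [set A | measurable A /\
           forall t, 0 <= t <= T -> F t (A `&` [set x | theta x <= t])].

Definition stopping_after (S : Omega -> R) : set (Omega -> R) :=
  [set theta | is_stopping theta /\ {ae P, forall x, S x <= theta x}].

Definition admissible (phi : sfamily) : Prop :=
  forall theta, is_stopping theta ->
    meas_wrt (F_at theta) (phi theta) /\
    forall theta', is_stopping theta' ->
      {ae P, forall x, theta x = theta' x -> phi theta x = phi theta' x}.

Definition fam_le (phi psi : sfamily) : Prop :=
  forall theta, is_stopping theta -> {ae P, forall x, (phi theta x <= psi theta x)%E}.

Definition fam_add (phi psi : sfamily) : sfamily :=
  fun theta x => (phi theta x + psi theta x)%E.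
Definition fam_sub (phi psi : sfamily) : sfamily :=
  fun theta x => (phi theta x - psi theta x)%E.
Definition fam_zero : sfamily := fun _ _ => 0%E.

Definition esssup_neg_integrable (phi : sfamily) : Prop :=
  exists Y, is_ess_sup is_stopping (fun theta => (phi theta)^\-%E) Y /\
            (\int[P]_x Y x < +oo)%E.
Definition esssup_pos_integrable (phi : sfamily) : Prop :=
  exists Y, is_ess_sup is_stopping (fun theta => (phi theta)^\+%E) Y /\
            (\int[P]_x Y x < +oo)%E.

Definition supermartingale_family (phi : sfamily) : Prop :=
  [/\ admissible phi, esssup_neg_integrable phi &
      forall theta theta', is_stopping theta -> is_stopping theta' ->
        {ae P, forall x, theta' x <= theta x} ->
        exists Y, is_cond_exp (F_at theta') (phi theta) Y /\
                  {ae P, forall x, (Y x <= phi theta' x)%E}].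

Definition is_snell (phi psi : sfamily) : Prop :=
  forall theta, is_stopping theta ->
    is_esssup_condexp (F_at theta) (stopping_after theta) phi (psi theta).

Definition fam_limsup (Jn : nat -> sfamily) : sfamily :=
  fun theta x => limn_esup (fun n => Jn n theta x).

End defs.

(* Main.v *)
Require Import Defs.
From mathcomp Require Import all_boot all_order all_algebra.
From mathcomp Require Import all_classical all_reals all_analysis.
From mathcomp Require Import measurable_realfun.
Set Implicit Arguments. Unset Strict Implicit. Unset Printing Implicit Defensive.
Import Order.TTheory GRing.Theory Num.Theory.
Local Open Scope classical_set_scope.
Local Open Scope ring_scope.

(**
The iterates J_n and J'_n are nondecreasing: J_1 and J'_1 dominate 0 because
stopping at T pays 0, and the Snell envelope is monotone.  So J and J' are
a.s. limits of nondecreasing sequences, and the fixed point equations follow by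
monotone convergence, first for conditional expectations, then for essential
suprema.  The same argument provides the conditional expectations that have to
exist: each of them is a monotone limit of conditional expectations given by the
hypotheses, so no Radon-Nikodym theorem is needed.

The Snell envelope of an admissible family phi is an admissible supermartingale
family.  Indeed the family E[phi(tau) | F_theta], tau >= theta, is directed
upwards (paste two stopping times along the F_theta-measurable event that one
conditional expectation exceeds the other), hence its essential supremum is the
limit of a nondecreasing sequence.  Minimality is an induction on n: if
J'_n <= H', then J'_n + xi <= H' + xi <= H, and a supermartingale family that
dominates a family dominates its Snell envelope.
*)

(** * Upper limits of nondecreasing sequences of extended reals *)

Section limn_esup_lemmas.
Local Open Scope ereal_scope.
Context {R : realType}.
Implicit Types (u v : (\bar R)^nat) (z : \bar R).

Lemma limn_esup_le u z : (forall n, u n <= z) -> limn_esup u <= z.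
Proof.
move=> uz; rewrite limn_esup_lim; apply: lime_le; first exact: is_cvg_esups.
by apply: nearW => n; apply: ge_ereal_sup => _ [k _ <-].
Qed.

Lemma nondecreasing_cvg_limn_esup u :
  (forall n, u n <= u n.+1) -> u @ \oo --> limn_esup u.
Proof.
move=> /nondecreasing_seqP ndu.
have cu : cvgn u by exact: ereal_nondecreasing_is_cvgn.
by rewrite is_cvg_limn_esupE.
Qed.

Lemma nondecreasing_le_limn_esup u n :
  (forall n, u n <= u n.+1) -> u n <= limn_esup u.
Proof.
move=> uS; have cu := nondecreasing_cvg_limn_esup uS.
rewrite -(cvg_lim _ cu)//; apply: lime_ge; first by apply: cvgP cu.
by exists n => // m /= nm; move/nondecreasing_seqP : uS; exact.
Qed.

(* The convention [+oo + -oo = -oo] makes this hold without any restriction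
   on [z]. *)
Lemma limn_esup_nondecreasingD u z : (forall n, 0 <= u n) ->
  (forall n, u n <= u n.+1) -> limn_esup (fun n => u n + z) = limn_esup u + z.
Proof.
move=> u0 uS.
have uzS n : u n + z <= u n.+1 + z by exact: leeD.
have ul := nondecreasing_cvg_limn_esup uS.
have l0 : 0 <= limn_esup u.
  exact: le_trans (u0 0%N) (nondecreasing_le_limn_esup _ uS).
apply/eqP; rewrite eq_le; apply/andP; split.
  by apply: limn_esup_le => n; rewrite leeD// nondecreasing_le_limn_esup.
case: z uzS => [r| |] uzS.
- rewrite -leeBrDr// ; apply: limn_esup_le => n.
  by rewrite leeBrDr// (nondecreasing_le_limn_esup n uzS).
- apply: le_trans (nondecreasing_le_limn_esup 0%N uzS).
  by rewrite !addey ?gt_eqF// (lt_le_trans ltNy0).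
- by rewrite addeNy leNye.
Qed.

Lemma limn_esup_shiftS u :
  limn_esup (fun n => u n.+1) = limn_esup u.
Proof.
rewrite !limn_esup_lim.
have -> : esups (fun n => u n.+1) = (fun n => esups u n.+1).
  apply/funext => n; congr ereal_sup; apply/seteqP; split => y [k /= nk <-].
    by exists k.+1.
  by case: k nk => // k nk; exists k.
by apply/cvg_lim => //; rewrite (cvg_shiftS (esups u)); exact: is_cvg_esups.
Qed.

End limn_esup_lemmas.

(** * Integrals of functions whose negative part is integrable *)

Section quasi_integrable.
Local Open Scope ereal_scope.
Context d (T : measurableType d) (R : realType).
Variable mu : {measure set T -> \bar R}.
Implicit Types (D : set T) (f g : T -> \bar R).

(** Positive and negative parts are compared separately. With the convention [+oo - +oo = -oo],
    subtraction stays monotone, so infinite integrals are covered. *)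
Lemma ae_le_integral D f g : measurable D ->
  measurable_fun D f -> measurable_fun D g ->
  {ae mu, forall x, D x -> f x <= g x} ->
  \int[mu]_(x in D) f x <= \int[mu]_(x in D) g x.
Proof.
move=> mD mf mg fg; rewrite integralE [leRHS]integralE; apply: leeB.
  apply: ae_ge0_le_integral => //; do 1?exact: measurable_funepos.
  apply: filterS fg => x fg Dx.
  by rewrite !funeposE ge_max !le_max lexx fg ?orbT.
apply: ae_ge0_le_integral => //; do 1?exact: measurable_funeneg.
apply: filterS fg => x fg Dx.
by rewrite !funenegE ge_max !le_max lexx leeN2 fg ?orbT.
Qed.

Lemma integrable_funeposneg D f : measurable D -> measurable_fun D f ->
  \int[mu]_(x in D) f^\+ x < +oo -> \int[mu]_(x in D) f^\- x < +oo ->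
  mu.-integrable D f.
Proof.
move=> mD mf fp fn; apply/integrableP; split => //.
under eq_integral do rewrite -/((abse \o f) _) fune_abse.
rewrite ge0_integralD//; first exact: lte_add_pinfty.
  exact: measurable_funepos.
exact: measurable_funeneg.
Qed.

Lemma funeneg_integral_lty_sub D f : measurable D -> measurable_fun setT f ->
  \int[mu]_x f^\- x < +oo -> \int[mu]_(x in D) f^\- x < +oo.
Proof.
move=> mD mf; apply: le_lt_trans; apply: ge0_subset_integral => //.
exact: measurable_funeneg.
Qed.

(** Positive parts converge by monotone convergence, negative parts by dominated convergence, with
    the negative part of [f 0] as dominating function. *)
Lemma cvg_integral_ae_nondecreasing D (f : (T -> \bar R)^nat) : measurable D ->
  (forall n, measurable_fun setT (f n)) ->
  (forall n, {ae mu, forall x, f n x <= f n.+1 x}) ->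
  \int[mu]_x (f 0%N)^\- x < +oo ->
  \int[mu]_(x in D) f n x @[n --> \oo] -->
  \int[mu]_(x in D) limn_esup (f ^~ x).
Proof.
move=> mD mf /ae_foralln aef f0.
have [N [mN N0 fN]] := aef.
have mfD n : measurable_fun D (f n) by exact: measurable_funS (mf n).
have ml : measurable_fun setT (fun x => limn_esup (f ^~ x)).
  exact: measurable_fun_limn_esup.
have mlD : measurable_fun D (fun x => limn_esup (f ^~ x)).
  exact: measurable_funS ml.
have fS x : ~ N x -> forall n, f n x <= f n.+1 x.
  by move=> Nx; apply: contrapT => /fN.
have fl x : ~ N x -> f ^~ x @ \oo --> limn_esup (f ^~ x).
  by move=> /fS; exact: nondecreasing_cvg_limn_esup.
have cvgmax (u : (\bar R)^nat) l : u @ \oo --> l ->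
    (fun n => maxe (u n) 0) @ \oo --> maxe l 0.
  move=> ul; apply: (@continuous2_cvg _ _ _ _ _ _ u (cst 0) maxe) => //.
    exact: (@max_continuous _ (\bar R) (l, 0)).
  exact: cvg_cst.
have f0D : \int[mu]_(x in D) (f 0%N)^\- x < +oo.
  exact: funeneg_integral_lty_sub.
have f0I : mu.-integrable D (f 0%N)^\-.
  apply/integrableP; split; first exact: measurable_funeneg.
  by under eq_integral do rewrite gee0_abs//.
have cn : \int[mu]_(x in D) (f n)^\- x @[n --> \oo] -->
    \int[mu]_(x in D) (fun x => limn_esup (f ^~ x))^\- x.
  have mfn n : measurable_fun D (f n)^\- by exact: measurable_funeneg.
  apply: (fun h1 h2 h3 => let: And3 _ _ h :=
    dominated_convergence mD mfn h1 h2 f0I h3 in h).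
  - exact: measurable_funeneg.
  - exists N; split => // x /= xP; apply: contrapT => Nx; apply: xP => _.
    rewrite funenegE; under eq_cvg do rewrite funenegE.
    by apply: cvgmax; apply: cvgeN; exact: fl.
  - exists N; split => // x /= xP; apply: contrapT => Nx; apply: xP => n _.
    rewrite gee0_abs// !funenegE ge_max !le_max lexx leeN2 ?orbT ?andbT.
    by have /nondecreasing_seqP -> := fS _ Nx.
have cp : \int[mu]_(x in D) (f n)^\+ x @[n --> \oo] -->
    \int[mu]_(x in D) (fun x => limn_esup (f ^~ x))^\+ x.
  rewrite (ge0_negligible_integral mN)//; last exact: measurable_funepos.
  under eq_cvg => n.
    rewrite (ge0_negligible_integral mN)//; last exact: measurable_funepos.
    over.
  rewrite (eq_integral (fun x => limn ((fun n => (f n)^\+) ^~ x))).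
    apply: cvg_monotone_convergence => //.
    + exact: measurableD.
    + by move=> n; apply: measurable_funepos; exact: measurable_funS (mf n).
    + move=> x [_ Nx]; apply/nondecreasing_seqP => n.
      by rewrite !funeposE ge_max !le_max lexx fS ?orbT.
  move=> x; rewrite inE => -[_ Nx]; apply/esym/cvg_lim => //.
  rewrite funeposE; under eq_cvg do rewrite funeposE.
  by apply: cvgmax; exact: fl.
(* Finiteness of this limit keeps the difference of the two limits from having the form
   [+oo - +oo]. *)
have ln : \int[mu]_(x in D) (fun x => limn_esup (f ^~ x))^\- x \is a fin_num.
  rewrite ge0_fin_numE; last exact: integral_ge0.
  apply: le_lt_trans f0D; apply: ae_ge0_le_integral => //.
  - exact: measurable_funeneg.
  - exact: measurable_funeneg.
  - apply: filterS aef => x xS _.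
    rewrite !funenegE ge_max !le_max lexx leeN2 ?orbT ?andbT.
    by rewrite (nondecreasing_le_limn_esup 0%N).
rewrite integralE; under eq_cvg do rewrite integralE.
by apply: cvgeB => //; rewrite fin_num_adde_defl// fin_numN.
Qed.
End quasi_integrable.

(** * Conditional expectations as a relation, and their monotone limits *)

Section conditional_expectation.
Local Open Scope ereal_scope.
Context {R : realType} {d : measure_display} {Omega : measurableType d}.
Variable P : probability Omega R.
Implicit Types (G : set (set Omega)) (X Y : Omega -> \bar R).

(** Turns a sub-sigma-algebra, given as a set of sets, into a measurable structure, so that general
    measurability results apply to it. *)
Lemma meas_wrtP G X : sigma_algebra setT G ->
  meas_wrt G X <-> measurable_fun (T := g_sigma_algebraType G) setT X.
Proof.
move=> sG; split => [mX _ B mB|mX B mB].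
  by rewrite setTI measurable_g_measurableTypeE//; exact: mX.
have := mX measurableT B mB.
by rewrite setTI measurable_g_measurableTypeE.
Qed.

Lemma meas_wrt_measurable G X :
  G `<=` measurable -> meas_wrt G X -> measurable_fun setT X.
Proof. by move=> Gm mX _ B mB; rewrite setTI; apply: Gm; exact: mX. Qed.

Lemma sigma_algebraI G A B : sigma_algebra setT G -> G A -> G B -> G (A `&` B).
Proof.
move=> sG; rewrite -(measurable_g_measurableTypeE sG); exact: measurableI.
Qed.

Lemma sigma_algebraU G A B : sigma_algebra setT G -> G A -> G B -> G (A `|` B).
Proof.
move=> sG; rewrite -(measurable_g_measurableTypeE sG); exact: measurableU.
Qed.

Lemma sigma_algebra_setC G A : sigma_algebra setT G -> G A -> G (~` A).
Proof.
move=> sG; rewrite -(measurable_g_measurableTypeE sG); exact: measurableC.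
Qed.

Lemma sigma_algebra_setT G : sigma_algebra setT G -> G setT.
Proof.
move=> sG; rewrite -(measurable_g_measurableTypeE sG); exact: measurableT.
Qed.

Lemma meas_wrt_lt G X Y : sigma_algebra setT G ->
  meas_wrt G X -> meas_wrt G Y -> G [set x | X x < Y x].
Proof.
move=> sG /(meas_wrtP _ sG) mX /(meas_wrtP _ sG) mY.
have := measurable_lte (@measurableT _ (g_sigma_algebraType G)) mX mY.
by rewrite setTI measurable_g_measurableTypeE.
Qed.

Lemma meas_wrt_limn_esup G (X : (Omega -> \bar R)^nat) : sigma_algebra setT G ->
  (forall n, meas_wrt G (X n)) -> meas_wrt G (fun x => limn_esup (X ^~ x)).
Proof.
move=> sG mX; apply/meas_wrtP => //.
apply: (@measurable_fun_limn_esup _ (g_sigma_algebraType G)) => n.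
exact/meas_wrtP.
Qed.

Lemma meas_wrt_add G X Y : sigma_algebra setT G ->
  meas_wrt G X -> meas_wrt G Y -> meas_wrt G (fun x => X x + Y x).
Proof.
move=> sG /(meas_wrtP _ sG) mX /(meas_wrtP _ sG) mY; apply/meas_wrtP => //.
exact: (@emeasurable_funD _ (g_sigma_algebraType G)).
Qed.

Lemma meas_wrt_cst G (c : \bar R) : sigma_algebra setT G -> meas_wrt G (cst c).
Proof.
move=> sG; exact/meas_wrtP.
Qed.

(** Measurability is asked of the trace of [X] on [A] only, because [X] may be measurable for
    another sigma-algebra that agrees with [G] inside [A]. *)
Lemma meas_wrt_if G A X c : sigma_algebra setT G -> G A ->
  (forall B, measurable B -> G (A `&` X @^-1` B)) ->
  meas_wrt G (fun x => if x \in A then X x else c).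
Proof.
move=> sG GA mX B mB.
rewrite (_ : _ @^-1` B = (A `&` X @^-1` B) `|` (~` A `&` (cst c) @^-1` B)).
  apply: sigma_algebraU => //; first exact: mX.
  apply: sigma_algebraI => //; first exact: sigma_algebra_setC.
  exact: meas_wrt_cst.
apply/seteqP; split => x /=; case: (pselect (A x)) => Ax.
- by rewrite mem_set//; left.
- by rewrite memNset//; right.
- by rewrite mem_set//; case => [[]|[]].
- by rewrite memNset//; case => [[]|[]].
Qed.

(** On the whole space [X] and [Y] have the same integral. If [X^\-] had integral [+oo], this common
    value would be [-oo], which the finite integral of [Y^\-] forbids. *)
Lemma cond_exp_funeneg_lty G X Y : sigma_algebra setT G ->
  is_cond_exp P G X Y -> \int[P]_x X^\- x < +oo.
Proof.
move=> sG [_ Yn /(_ _ (sigma_algebra_setT sG))].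
rewrite integralE [in X in _ = X -> _]integralE => YX.
rewrite ltNge leye_eq; apply/negP => /eqP Xn; move: YX; rewrite Xn addeNy.
have Yf : \int[P]_x Y^\- x \is a fin_num.
  by rewrite ge0_fin_numE//; exact: integral_ge0.
move/eqP; rewrite adde_eq_ninfty => /orP[/eqP|].
  by apply/eqP; rewrite gt_eqF// (lt_le_trans ltNy0)//; exact: integral_ge0.
by rewrite -(fineK Yf).
Qed.

(* It suffices to see that [A `&` {Y2 < Y1} `&` {Y2 < m}] is null for every [m]:
   there [Y2], hence [Y1], is integrable, so that the two integrals may be
   subtracted. *)
Lemma cond_exp_le_on (G1 G2 : set (set Omega)) A X1 X2 Y1 Y2 :
  sigma_algebra setT G1 -> sigma_algebra setT G2 ->
  G1 `<=` measurable -> G2 `<=` measurable ->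
  G1 A -> (forall B, B `<=` A -> G1 B <-> G2 B) ->
  measurable_fun setT X1 -> measurable_fun setT X2 ->
  {ae P, forall x, A x -> X1 x <= X2 x} ->
  is_cond_exp P G1 X1 Y1 -> is_cond_exp P G2 X2 Y2 ->
  {ae P, forall x, A x -> Y1 x <= Y2 x}.
Proof.
move=> sG1 sG2 G1m G2m G1A G12 mX1 mX2 X12 [mY1 Y1n Y1E] [mY2 Y2n Y2E].
have G2A : G2 A by exact/G12.
have mY1' := meas_wrt_measurable G1m mY1.
have mY2' := meas_wrt_measurable G2m mY2.
(* [Y2] is [G2]-measurable, but its restriction to [A] has a [G1]-measurable extension [Z]. The
   value [+oo] outside [A] makes [Z < Y1] possible only inside [A]. *)
pose Z x := if x \in A then Y2 x else +oo.
have mZ : meas_wrt G1 Z.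
  apply: meas_wrt_if => // B mB; apply/G12; first by move=> x [].
  by apply: sigma_algebraI => //; exact: mY2.
pose B m := [set x | Z x < Y1 x] `&` [set x | Z x < m%:R%:E].
have G1B m : G1 (B m).
  apply: sigma_algebraI => //; first exact: meas_wrt_lt.
  by apply: meas_wrt_lt => //; exact: meas_wrt_cst.
have BA m : B m `<=` A.
  move=> x [/= + _]; rewrite /Z; case: ifPn => [/set_mem//|_].
  by rewrite ltNge leey.
have G2B m : G2 (B m) by apply/G12; [exact: BA|exact: G1B].
have ZE m x : B m x -> Z x = Y2 x by move=> /BA Ax; rewrite /Z mem_set.
have B0 m : P.-negligible (B m).
  have mB := G1m _ (G1B m).
  have mY1B : measurable_fun (B m) Y1 by exact: measurable_funS mY1'.
  have mY2B : measurable_fun (B m) Y2 by exact: measurable_funS mY2'.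
  have Y12 : \int[P]_(x in B m) Y1 x <= \int[P]_(x in B m) Y2 x.
    rewrite Y1E// Y2E//; apply: ae_le_integral => //.
    - exact: measurable_funS mX1.
    - exact: measurable_funS mX2.
    - by apply: filterS X12 => x + /BA; apply.
  have Y1nB := funeneg_integral_lty_sub mB mY1' Y1n.
  have Y2nB := funeneg_integral_lty_sub mB mY2' Y2n.
  have iY2 : P.-integrable (B m) Y2.
    apply: integrable_funeposneg => //.
    apply: (@le_lt_trans _ _ (\int[P]_(x in B m) (cst m%:R%:E) x)).
      apply: ge0_le_integral => //; first exact: measurable_funepos.
      move=> x Bx; rewrite funeposE ge_max lee_fin ler0n andbT.
      by have := Bx.2; rewrite /= (ZE _ _ Bx) => /ltW.
    rewrite integral_cst//.
    rewrite (@le_lt_trans _ _ m%:R%:E) ?ltry//.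
    by rewrite muleC gee_pMl// ?probability_le1// ?fin_num_measure// lee_fin.
  have iY1 : P.-integrable (B m) Y1.
    apply: integrable_funeposneg => //.
    have Y2f := integrable_fin_num mB iY2.
    have Y1f : \int[P]_(x in B m) Y1^\- x \is a fin_num.
      by rewrite ge0_fin_numE//; exact: integral_ge0.
    have := Y12; rewrite (integralE _ _ Y1) leeBlDr//.
    move=> /le_lt_trans; apply; apply: lte_add_pinfty => //.
    by rewrite ltey_eq Y2f.
  have dgt0 x : B m x -> 0 < Y1 x - Y2 x.
    by move=> Bx; have := Bx.1; rewrite /= (ZE _ _ Bx) sube_gt0.
  have : \int[P]_(x in B m) `|(Y1 \- Y2) x| = 0.
    apply/eqP; rewrite eq_le integral_ge0// andbT.
    rewrite (eq_integral (Y1 \- Y2)).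
      by rewrite integralB// sube_le0.
    by move=> x /set_mem Bx; rewrite gee0_abs//; exact/ltW/dgt0.
  move/ae_eq_integral_abs => /(_ mB (emeasurable_funB mY1B mY2B)).
  apply: negligibleS => x Bx /= /(_ Bx) /eqP.
  by rewrite gt_eqF// dgt0.
apply: negligibleS (negligible_bigcup B0) => x /= /not_implyP[Ax /negP].
rewrite -ltNge => lt21.
have [m Y2m] : exists m : nat, Y2 x < m%:R%:E.
  move: lt21; case: (Y2 x) => [r|/=|] lt21.
  - exists (Num.bound `|r|); rewrite lte_fin (le_lt_trans (ler_norm r))//.
    exact: archi_boundP.
  - by move: lt21; rewrite ltNge leey.
  - by exists 0%N; exact: ltNyr.
by exists m => //; split; rewrite /= /Z mem_set.
Qed.

Lemma cond_exp_le G X1 X2 Y1 Y2 :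
  sigma_algebra setT G -> G `<=` measurable ->
  measurable_fun setT X1 -> measurable_fun setT X2 ->
  {ae P, forall x, X1 x <= X2 x} ->
  is_cond_exp P G X1 Y1 -> is_cond_exp P G X2 Y2 ->
  {ae P, forall x, Y1 x <= Y2 x}.
Proof.
move=> sG Gm mX1 mX2 X12 Y1E Y2E.
suff: {ae P, forall x, setT x -> Y1 x <= Y2 x} by apply: filterS => x; exact.
apply: (cond_exp_le_on sG sG Gm Gm _ _ mX1 mX2 _ Y1E Y2E) => //.
  exact: sigma_algebra_setT.
by apply: filterS X12.
Qed.

(** Conditional monotone convergence, which also supplies the existence of the conditional
    expectation of the limit. [Yn] is almost surely nondecreasing by monotonicity, and over each set
    of [G] the equal integrals of [Xn n] and [Yn n] converge to those of the two limits. *)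
Lemma cond_exp_limn_esup G X (Xn Yn : (Omega -> \bar R)^nat) :
  sigma_algebra setT G -> G `<=` measurable ->
  (forall n, measurable_fun setT (Xn n)) -> measurable_fun setT X ->
  (forall n, {ae P, forall x, Xn n x <= Xn n.+1 x}) ->
  {ae P, forall x, X x = limn_esup (Xn ^~ x)} ->
  (forall n, is_cond_exp P G (Xn n) (Yn n)) ->
  is_cond_exp P G X (fun x => limn_esup (Yn ^~ x)).
Proof.
move=> sG Gm mXn mX XnS XE YnE.
have GYn n : meas_wrt G (Yn n) by have [] := YnE n.
have mYn n : measurable_fun setT (Yn n) by exact: meas_wrt_measurable (GYn n).
have YnS n : {ae P, forall x, Yn n x <= Yn n.+1 x}.
  exact: cond_exp_le (YnE n) (YnE n.+1).
have Y0n : \int[P]_x (Yn 0%N)^\- x < +oo by have [] := YnE 0%N.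
have X0n := cond_exp_funeneg_lty sG (YnE 0%N).
have mY : measurable_fun setT (fun x => limn_esup (Yn ^~ x)).
  exact: measurable_fun_limn_esup.
split; first exact: meas_wrt_limn_esup.
- apply: le_lt_trans Y0n; apply: ae_ge0_le_integral => //.
  + exact: measurable_funeneg.
  + exact: measurable_funeneg.
  + have /ae_foralln := YnS; apply: filterS => x YS _.
    rewrite !funenegE ge_max !le_max lexx leeN2 ?orbT ?andbT.
    by rewrite (nondecreasing_le_limn_esup 0%N).
- move=> A GA; have mA := Gm _ GA.
  rewrite [RHS](ae_eq_integral (fun x => limn_esup (Xn ^~ x))) => //; last 3 first.
  + exact: measurable_funS mX.
  + apply: measurable_fun_limn_esup => n; exact: measurable_funS (mXn n).
  + by apply: filterS XE => x ->.
  have YA := @cvg_integral_ae_nondecreasing _ _ _ P A Yn mA mYn YnS Y0n.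
  have XA := @cvg_integral_ae_nondecreasing _ _ _ P A Xn mA mXn XnS X0n.
  have E : (fun n => \int[P]_(x in A) Yn n x) =
           (fun n => \int[P]_(x in A) Xn n x).
    by apply/funext => n; have [_ _] := YnE n; apply.
  rewrite E in YA; exact: cvg_unique YA XA.
Qed.

Lemma cond_exp_tower G1 G2 X Y1 Y2 : G2 `<=` G1 ->
  is_cond_exp P G1 X Y1 -> is_cond_exp P G2 X Y2 -> is_cond_exp P G2 Y1 Y2.
Proof.
move=> G21 [_ _ Y1E] [mY2 Y2n Y2E]; split => // A GA.
by rewrite Y2E// Y1E//; exact: G21.
Qed.

End conditional_expectation.

(** * Essential suprema through countable subfamilies *)

Section essential_supremum.
Local Open Scope ereal_scope.
Context {R : realType} {d : measure_display} {Omega : measurableType d}.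
Variable P : probability Omega R.

Lemma lte_rat (x y : \bar R) : x < y ->
  exists q : rat, x < (ratr q)%:E < y.
Proof.
have real_rat (a b : R) : (a < b)%R -> exists q : rat, a%:E < (ratr q)%:E < b%:E.
  move=> /rat_in_itvoo[q]; rewrite in_itv /= => /andP[aq qb].
  by exists q; rewrite !lte_fin aq qb.
case: x y => [a| |] [b| |]//.
- by rewrite lte_fin => /real_rat.
- move=> _; have [|q /andP[aq _]] := real_rat a (a + 1)%R; first by rewrite ltrDl.
  by exists q; rewrite aq ltry.
- move=> _; have [|q /andP[_ qb]] := real_rat (b - 1)%R b.
    by rewrite ltrBlDr ltrDl.
  by exists q; rewrite qb ltNyr.
- by move=> _; exists 0%R; rewrite ltry ltNyr.
Qed.

Lemma merge_sequences (K : Type) (I : set K) (s : nat -> nat -> K) :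
  (forall a b, I (s a b)) ->
  exists2 t : nat -> K, (forall k, I (t k)) & forall a b, exists k, t k = s a b.
Proof.
move=> Is.
(* Pairs are enumerated by their codes; a number that codes no pair gets the default [s 0 0], which
   keeps the values in [I]. *)
exists (fun k => if @unpickle (nat * nat)%type k is Some ab then s ab.1 ab.2
                 else s 0%N 0%N).
  by move=> k; case: unpickle.
by move=> a b; exists (pickle (a, b)); rewrite pickleK.
Qed.

(** Among countable unions of the sets [A i], one reaches the supremum of the probabilities.
    Adjoining a further [A i] gives another countable union, so it cannot add mass. *)
Lemma exhausting_sequence (K : Type) (I : set K) (A : K -> set Omega) :
  I !=set0 -> (forall i, I i -> measurable (A i)) ->
  exists2 s : nat -> K, (forall k, I (s k)) &
    forall i, I i -> P.-negligible (A i `\` \bigcup_k A (s k)).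
Proof.
move=> [i0 Ii0] mA.
pose U (s : nat -> K) := \bigcup_k A (s k).
have mU s : (forall k, I (s k)) -> measurable (U s).
  by move=> Is; apply: bigcup_measurable => k _; exact: mA.
pose S := [set P (U s) | s in [set s | forall k, I (s k)]].
have S1 : ereal_sup S <= 1.
  by apply: ge_ereal_sup => _ [s Is <-]; exact: probability_le1 (mU _ Is).
have S0 : 0 <= ereal_sup S.
  by apply: le_ereal_sup_tmp; exists (P (U (cst i0))) => //; exists (cst i0).
have Sfin : ereal_sup S \is a fin_num.
  by rewrite ge0_fin_numE// (le_lt_trans S1)// ltry.
have /choice[s sP] (n : nat) : exists s : nat -> K, (forall k, I (s k)) /\
    ereal_sup S - n.+1%:R^-1%:E < P (U s).
  have [|_ [s Is <-] ?] := @ub_ereal_sup_adherent _ S n.+1%:R^-1%R _ Sfin.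
    by rewrite invr_gt0.
  by exists s.
have [t It ts] := merge_sequences (fun a b => (sP a).1 b).
exists t => // i Ii.
have SU : ereal_sup S <= P (U t).
  apply/lee_addgt0Pr => e e0.
  pose n := Num.bound e^-1; have ne : (n.+1%:R^-1 < e)%R.
    rewrite invf_plt ?posrE//; apply: lt_trans (_ : n%:R < _)%R.
      by apply: archi_boundP; rewrite invr_ge0 ltW.
    by rewrite ltr_nat.
  have := (sP n).2; rewrite lteBlDr// => /ltW/le_trans; apply.
  apply: leeD; last by rewrite lee_fin ltW.
  apply: le_measure; rewrite ?inE; [exact: mU (sP n).1|exact: mU|].
  by move=> x [k _ Akx]; have [j tj] := ts n k; exists j => //; rewrite tj.
(* The sequence [t] with [i] put in front: its union exceeds that of [t] exactly by the part of
   [A i] outside [U t]. *)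
pose t' k := if k is k'.+1 then t k' else i.
have It' k : I (t' k) by case: k.
have Ut' : U t' = A i `\` U t `|` U t.
  apply/seteqP; split=> [x [[|k] _ Ax]|x [[Ax _]|[k _ Ax]]].
  - by case: (pselect (U t x)) => ?; [right|left].
  - by right; exists k.
  - by exists 0%N.
  - by exists k.+1.
have mAU : measurable (A i `\` U t).
  by apply: measurableD; [exact: mA|exact: mU].
apply/negligibleP => //.
have : P (U t') <= P (U t).
  by apply: le_trans SU; apply: ereal_sup_ubound; exists t'.
have Uf : P (U t) \is a fin_num by apply: fin_num_measure; exact: mU.
rewrite Ut' measureU//; [|exact: mU|by rewrite setDE setIAC -setIA setICr setI0].
rewrite -leeBrDr// subee// => ?; apply/eqP.
by rewrite eq_le measure_ge0 andbT.
Qed.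

(** Exhaustion is applied to the level sets [{q < X i}] for every rational [q]. If [X i] exceeded
    the countable supremum at [x], a rational in between would place [x] in one of countably many
    null sets. The countable supremum is thus an almost sure upper bound, and minimality of [Y]
    applies. *)
Lemma ess_sup_sequence (I : set (Omega -> R)) (X : sfamily) Y :
  I !=set0 -> (forall i, I i -> measurable_fun setT (X i)) ->
  is_ess_sup P I X Y ->
  exists2 s : nat -> Omega -> R, (forall k, I (s k)) &
    {ae P, forall x, Y x <= ereal_sup (range (fun k => X (s k) x))}.
Proof.
move=> I0 mX [mY XY Ymin].
pose q n : R := ratr (odflt 0%R (@unpickle rat n)).
pose A n i := [set x | (q n)%:E < X i x].
have mA n i : I i -> measurable (A n i).
  move=> Ii; rewrite -[A n i]setTI; apply: measurable_lte => //.
  exact: mX.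
have /choice[s sP] (n : nat) : exists s : nat -> Omega -> R,
    (forall k, I (s k)) /\
    forall i, I i -> P.-negligible (A n i `\` \bigcup_k A n (s k)).
  by have [s ? ?] := exhausting_sequence I0 (mA n); exists s.
have [t It ts] := merge_sequences (fun a b => (sP a).1 b).
exists t => //.
have esupsE x : esups (fun k => X (t k) x) 0%N =
    ereal_sup (range (fun k => X (t k) x)).
  by congr ereal_sup; apply/seteqP; split => y [k _ <-]; exists k.
suff : {ae P, forall x, Y x <= esups (fun k => X (t k) x) 0%N}.
  by apply: filterS => x; rewrite esupsE.
apply: Ymin; first by apply: measurable_fun_esups => n; exact: mX.
move=> i Ii.
have : P.-negligible (\bigcup_n (A n i `\` \bigcup_k A n (s n k))).
  by apply: negligible_bigcup => n; exact: (sP n).2.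
apply: negligibleS => x /= /negP; rewrite -ltNge esupsE.
move=> /lte_rat[r /andP[Zr rX]].
exists (pickle r) => //; split; first by rewrite /A /q /= pickleK.
move=> [k _]; rewrite /A /q /= pickleK /=; apply/negP; rewrite -leNgt.
have [j tj] := ts (pickle r) k.
apply: le_trans (ltW Zr).
by apply: ereal_sup_ubound; exists j => //; rewrite tj.
Qed.

(** Directedness replaces finite maxima: [s n.+1] dominates both [s n] and [t n.+1], where [t] is a
    sequence whose supremum bounds [Y]. Hence [Y] is at most the supremum along [t], which is at
    most the limit along [s], which is at most [Y]. *)
Lemma ess_sup_directed (I : set (Omega -> R)) (X : sfamily) Y :
  I !=set0 -> (forall i, I i -> measurable_fun setT (X i)) ->
  (forall i j, I i -> I j -> exists2 k, I k &
    {ae P, forall x, X i x <= X k x /\ X j x <= X k x}) ->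
  is_ess_sup P I X Y ->
  exists s : nat -> Omega -> R, [/\ forall n, I (s n),
    forall n, {ae P, forall x, X (s n) x <= X (s n.+1) x} &
    {ae P, forall x, Y x = limn_esup (fun n => X (s n) x)}].
Proof.
move=> I0 mX dirX YE; have [_ XY _] := YE.
have [t It Yt] := ess_sup_sequence I0 mX YE.
have /choice[f fP] (ij : (Omega -> R) * (Omega -> R)) : exists k,
    I ij.1 -> I ij.2 -> I k /\
    {ae P, forall x, X ij.1 x <= X k x /\ X ij.2 x <= X k x}.
  case: (pselect (I ij.1)) => [Ii|]; last by exists ij.1.
  case: (pselect (I ij.2)) => [Ij|]; last by exists ij.1.
  by have [k ? ?] := dirX _ _ Ii Ij; exists k.
pose s := fix s n := if n is n'.+1 then f (s n', t n) else t 0%N.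
have Is n : I (s n) by elim: n => //= n In; exact: (fP (s n, t n.+1) In (It _)).1.
have sf n := (fP (s n, t n.+1) (Is n) (It _)).2.
have sS n : {ae P, forall x, X (s n) x <= X (s n.+1) x}.
  by apply: filterS (sf n) => x [].
have ts n : {ae P, forall x, X (t n) x <= X (s n) x}.
  by case: n => [|n]; [exact: aeW|apply: filterS (sf n) => x []].
exists s; split => //.
have sY n := XY _ (Is n).
have ubY : {ae P, forall x, limn_esup (fun n => X (s n) x) <= Y x}.
  by apply: filterS (ae_foralln sY) => x; exact: limn_esup_le.
have lbY : {ae P, forall x, Y x <= limn_esup (fun n => X (s n) x)}.
  apply: filterS3 (ae_foralln sS) (ae_foralln ts) Yt => x xS xts xYt.
  apply: le_trans xYt _; apply: ge_ereal_sup => _ [n _ <-].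
  exact: le_trans (xts n) (nondecreasing_le_limn_esup n xS).
by apply: filterS2 ubY lbY => x h1 h2; apply/eqP; rewrite eq_le h1 h2.
Qed.

End essential_supremum.

(** * Stopping times and their sigma-algebras *)

Section stopping_times.
Context {R : realType} {d : measure_display} {Omega : measurableType d}.
Variables (P : probability Omega R) (T : R) (F : R -> set (set Omega)).
Hypotheses (HT : 0 < T) (HF : usual_filtration P T F).
Implicit Types (theta tau : Omega -> R) (A B : set Omega).

Lemma filtration_sigma_algebra t : 0 <= t <= T -> sigma_algebra setT (F t).
Proof. by move=> tT; have [/(_ t tT)[]] := HF. Qed.

Lemma filtration_measurable t : 0 <= t <= T -> F t `<=` measurable.
Proof. by move=> tT; have [/(_ t tT)[]] := HF. Qed.

Lemma filtration_mono s t A : 0 <= s -> s <= t -> t <= T -> F s A -> F t A.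
Proof. by move=> s0 st tT; have [_ + _ _ _] := HF; exact. Qed.

Lemma filtration_negligible t A : 0 <= t <= T -> P.-negligible A -> F t A.
Proof.
move=> /andP[t0 tT] [N [mN N0 AN]].
apply: (filtration_mono (lexx 0) t0 tT).
by have [_ _ _ + _] := HF; move=> /(_ N mN N0); exact.
Qed.

Lemma F_at_measurable theta : F_at T F theta `<=` measurable.
Proof. by move=> A []. Qed.

(** The measurability clause of [F_at] is the case [t = T], because [theta <= T] everywhere. *)
Lemma F_atP theta A : is_stopping T F theta ->
  (forall t, 0 <= t <= T -> F t (A `&` [set x | theta x <= t])) ->
  F_at T F theta A.
Proof.
move=> [thT _] At; split => //.
have := At T; rewrite lexx ltW// => /(_ isT) /filtration_measurable.
rewrite lexx ltW// => /(_ isT); congr measurable.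
by apply/seteqP; split => [x []//|x Ax]; split => //=; case/andP: (thT x).
Qed.

Lemma F_at_sigma_algebra theta :
  is_stopping T F theta -> sigma_algebra setT (F_at T F theta).
Proof.
move=> sth; split.
- apply: F_atP => // t /filtration_sigma_algebra[F0 _ _].
  by rewrite set0I.
- move=> A [_ At]; apply: F_atP => // t tT.
  have sF := filtration_sigma_algebra tT.
  rewrite (_ : _ `&` _ =
    [set x | theta x <= t] `&` ~` (A `&` [set x | theta x <= t])).
    apply: sigma_algebraI => //; first exact: sth.2.
    by apply: sigma_algebra_setC => //; exact: At.
  apply/seteqP; split => x /=.
    by move=> [[_ nA] tht]; split => // -[].
  by move=> [tht nA]; split => //; split => // Ax; apply: nA.
- move=> A At; apply: F_atP => // t tT.
  have [_ _ FU] := filtration_sigma_algebra tT.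
  by rewrite setI_bigcupl; apply: FU => n; exact: (At n).2.
Qed.

Lemma F_at_negligible theta A :
  is_stopping T F theta -> P.-negligible A -> F_at T F theta A.
Proof.
move=> sth A0; apply: F_atP => // t tT; apply: filtration_negligible => //.
by apply: negligibleS A0 => x [].
Qed.

(** The order holds only almost surely. Where it holds, [tau <= t] implies [theta <= t]; the rest is
    a null set, which completeness places in [F t]. *)
Lemma F_at_le theta tau : is_stopping T F theta -> is_stopping T F tau ->
  {ae P, forall x, theta x <= tau x} -> F_at T F theta `<=` F_at T F tau.
Proof.
move=> sth sta tht A [_ At]; apply: F_atP => // t tT.
have sF := filtration_sigma_algebra tT.
rewrite (_ : _ `&` _ =
  ((A `&` [set x | theta x <= t]) `&` [set x | tau x <= t]) `|`
  ((A `&` [set x | tau x <= t]) `&` ~` [set x | theta x <= tau x])).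
  apply: sigma_algebraU => //.
    by apply: sigma_algebraI => //; [exact: At|exact: sta.2].
  by apply: filtration_negligible => //; apply: negligibleS tht => x [].
apply/seteqP; split => x /=.
  move=> [Ax tat]; case: (pselect (theta x <= tau x)) => [h|h].
    by left; split => //; split => //; exact: le_trans h tat.
  by right.
by case => [[[]]|[[]]].
Qed.

Lemma meas_wrt_ae_eq theta (X Y : Omega -> \bar R) : is_stopping T F theta ->
  {ae P, forall x, X x = Y x} ->
  meas_wrt (F_at T F theta) X -> meas_wrt (F_at T F theta) Y.
Proof.
move=> sth XY mX B mB; have sF := F_at_sigma_algebra sth.
rewrite (_ : Y @^-1` B = (X @^-1` B `&` [set x | X x = Y x]) `|`
  (Y @^-1` B `&` ~` [set x | X x = Y x])).
  apply: sigma_algebraU => //.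
    apply: sigma_algebraI => //; first exact: mX.
    rewrite -[X in F_at _ _ _ X]setCK; apply: sigma_algebra_setC => //.
    exact: F_at_negligible.
  by apply: F_at_negligible => //; apply: negligibleS XY => x [].
apply/seteqP; split => x /=.
  move=> BY; case: (pselect (X x = Y x)) => XYx; last by right.
  by left; split => //; rewrite XYx.
by case => [[+ XYx]|[]//]; rewrite XYx.
Qed.

Lemma is_stopping_cstT : is_stopping T F (fun _ => T).
Proof.
split => [x|t tT]; first by rewrite lexx ltW.
have sF := filtration_sigma_algebra tT; case: (leP T t) => Tt.
  by rewrite set_true; exact: sigma_algebra_setT.
by rewrite set_false; case: sF.
Qed.

Lemma stopping_after_cstT theta :
  is_stopping T F theta -> stopping_after P T F theta (fun _ => T).
Proof.
move=> [thT _]; split; first exact: is_stopping_cstT.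
by apply: aeW => x; case/andP: (thT x).
Qed.

Lemma stopping_after_trans theta tau sigma :
  {ae P, forall x, theta x <= tau x} ->
  stopping_after P T F tau sigma -> stopping_after P T F theta sigma.
Proof.
move=> tht [sst ts]; split => //.
by apply: filterS2 tht ts => x; exact: le_trans.
Qed.

Definition paste A tau1 tau2 x := if x \in A then tau1 x else tau2 x.

(** The event that the pasted time is at most [t] splits along [A]; both [A] and its complement lie
    in the sigma-algebra of [theta], hence in those of the two later times. *)
Lemma stopping_after_paste theta A tau1 tau2 : is_stopping T F theta ->
  F_at T F theta A -> stopping_after P T F theta tau1 ->
  stopping_after P T F theta tau2 ->
  stopping_after P T F theta (paste A tau1 tau2).
Proof.
move=> sth thA [st1 t1] [st2 t2]; split; last first.
  by apply: filterS2 t1 t2 => x; rewrite /paste; case: ifP.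
split => [x|t tT]; first by rewrite /paste; case: ifP; [case: st1|case: st2].
have sF := filtration_sigma_algebra tT.
have [_ A1] := F_at_le sth st1 t1 thA.
have [_ A2] := F_at_le sth st2 t2
  (sigma_algebra_setC (F_at_sigma_algebra sth) thA).
rewrite (_ : mkset _ = (A `&` [set x | tau1 x <= t]) `|`
  (~` A `&` [set x | tau2 x <= t])).
  by apply: sigma_algebraU => //; [exact: A1|exact: A2].
apply/seteqP; split => x; rewrite /paste /=; case: (pselect (A x)) => Ax.
- by rewrite mem_set//; left.
- by rewrite memNset//; right.
- by rewrite mem_set//; case => [[]|[]].
- by rewrite memNset//; case => [[]|[]].
Qed.

Lemma sigma_algebra_bigcup_rat (G : set (set Omega)) (A : rat -> set Omega) :
  sigma_algebra setT G -> (forall q, G (A q)) -> G (\bigcup_q A q).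
Proof.
move=> sG; rewrite -(measurable_g_measurableTypeE sG).
exact: bigcupT_measurable_rat.
Qed.

(** The complement is the union of two strict inequalities, each of which is a countable union of
    events, since a rational [q] separates two distinct times. *)
Lemma F_at_eq theta tau : is_stopping T F theta -> is_stopping T F tau ->
  F_at T F theta [set x | theta x = tau x].
Proof.
move=> sth sta; have sFth := F_at_sigma_algebra sth.
(* The event [s1 <= q < s2], kept only for [q] in [[0, t]] so that it always belongs to [F t]. *)
pose D (s1 s2 : Omega -> R) (t q : R) : set Omega :=
  if 0 <= q <= t then [set x | s1 x <= q] `&` ~` [set x | s2 x <= q] else set0.
have diff s1 s2 q t : is_stopping T F s1 -> is_stopping T F s2 ->
    0 <= t <= T -> F t (D s1 s2 t q).
  move=> [_ h1] [_ h2] /andP[t0 tT]; rewrite /D; case: ifP => [/andP[q0 qt]|_]; last first.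
    by case: (@filtration_sigma_algebra t); rewrite // t0.
  have qT : 0 <= q <= T by rewrite q0 (le_trans qt).
  apply: (filtration_mono q0 qt tT); have sF := filtration_sigma_algebra qT.
  apply: sigma_algebraI => //; first exact: h1.
  by apply: sigma_algebra_setC => //; exact: h2.
rewrite (_ : mkset _ =
  ~` [set x | theta x < tau x] `&` ~` [set x | tau x < theta x]); last first.
  apply/seteqP; split => x /=; first by move=> ->; rewrite ltxx.
  by move=> [/negP + /negP]; rewrite -!leNgt => h1 h2; apply/eqP; rewrite eq_le h2.
apply: sigma_algebraI => //; apply: sigma_algebra_setC => //;
  apply: F_atP => // t tT; have sF := filtration_sigma_algebra tT.
(* The level [q = t] covers the paths with [theta <= t < tau], for which no separating rational need
   lie below [t]. *)
- have -> : [set x | theta x < tau x] `&` [set x | theta x <= t] =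
      (\bigcup_q D theta tau t (ratr q)) `|` D theta tau t t.
    have [t0 _] := andP tT; rewrite /D lexx t0 /=.
    apply/seteqP; split => x /=.
      move=> [thta tht]; have [tat|] := leP (tau x) t; last by right.
      have [q] := rat_in_itvoo thta; rewrite in_itv /= => /andP[thq qta].
      left; exists q => //; rewrite (le_trans _ (ltW thq)) ?(le_trans (ltW qta))//=.
        by split; [exact: ltW|apply/negP; rewrite -ltNge].
      by case/andP: (sth.1 x).
    case => [[q _]|[tht /negP]]; last by rewrite -ltNge => ?; split => //; exact: le_lt_trans tht _.
    case: ifP => // /andP[_ qt] [/= thq /negP]; rewrite -ltNge => qta.
    by split; [exact: le_lt_trans qta|exact: le_trans qt].
  apply: sigma_algebraU => //; last exact: diff.
  by apply: sigma_algebra_bigcup_rat => // q; exact: diff.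
- have -> : [set x | tau x < theta x] `&` [set x | theta x <= t] =
      (\bigcup_q D tau theta t (ratr q)) `&` [set x | theta x <= t].
    rewrite /D; apply/seteqP; split => x /=.
      move=> [tath tht]; split => //.
      have [q] := rat_in_itvoo tath; rewrite in_itv /= => /andP[taq qth].
      exists q => //; rewrite (le_trans _ (ltW taq)) ?(le_trans (ltW qth))//=.
        by split; [exact: ltW|apply/negP; rewrite -ltNge].
      by case/andP: (sta.1 x).
    move=> [[q _] + tht].
    case: ifP => // _ [/= taq /negP]; rewrite -ltNge => qth.
    by split => //; exact: le_lt_trans qth.
  apply: sigma_algebraI => //; last exact: sth.2.
  by apply: sigma_algebra_bigcup_rat => // q; exact: diff.
Qed.

(** Inside [{theta = tau}] the conditions [theta <= t] and [tau <= t] coincide. *)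
Lemma F_at_trace theta tau A B : is_stopping T F tau ->
  A `<=` [set x | theta x = tau x] -> B `<=` A ->
  F_at T F theta B -> F_at T F tau B.
Proof.
move=> sta Atht BA [_ Bt]; apply: F_atP => // t tT.
rewrite (_ : _ `&` _ = B `&` [set x | theta x <= t]); first exact: Bt.
by apply/seteqP; split => x [Bx] /=; have /= -> := Atht _ (BA _ Bx).
Qed.

End stopping_times.

(** * Snell envelopes of admissible families *)

Section snell_envelope.
Local Open Scope ereal_scope.
Context {R : realType} {d : measure_display} {Omega : measurableType d}.
Variables (P : probability Omega R) (T : R) (F : R -> set (set Omega)).
Hypotheses (HT : (0 < T)%R) (HF : usual_filtration P T F).
Implicit Types (theta tau : Omega -> R) (phi psi chi H : @sfamily R d Omega).

Local Notation stopping := (is_stopping T F).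
Local Notation after := (stopping_after P T F).
Let sF_at theta (sth : stopping theta) := F_at_sigma_algebra HT HF sth.
Let F_atm theta := @F_at_measurable R d Omega T F theta.

Lemma fam_le_trans phi psi chi : fam_le P T F phi psi -> fam_le P T F psi chi ->
  fam_le P T F phi chi.
Proof.
move=> le1 le2 theta sth.
by apply: filterS2 (le1 _ sth) (le2 _ sth) => x; exact: le_trans.
Qed.

Lemma fam_add_le phi1 phi2 psi :
  fam_le P T F phi1 phi2 ->
  fam_le P T F (fam_add phi1 psi) (fam_add phi2 psi).
Proof.
by move=> le12 theta /le12; apply: filterS => x ?; exact: leeD.
Qed.

Lemma admissible_measurable phi theta : admissible P T F phi ->
  stopping theta -> measurable_fun setT (phi theta).
Proof.
move=> aphi sth; have [mphi _] := aphi _ sth.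
exact: meas_wrt_measurable mphi.
Qed.

Lemma admissible_zero : admissible P T F fam_zero.
Proof.
move=> theta sth; split; last by move=> tau _; exact: aeW.
exact: meas_wrt_cst (sF_at sth).
Qed.

Lemma admissible_add phi psi : admissible P T F phi -> admissible P T F psi ->
  admissible P T F (fam_add phi psi).
Proof.
move=> aphi apsi theta sth; split.
  apply: meas_wrt_add; first exact: sF_at.
    by have [] := aphi _ sth.
  by have [] := apsi _ sth.
move=> tau sta; have [_ /(_ _ sta) h1] := aphi _ sth.
have [_ /(_ _ sta) h2] := apsi _ sth.
by apply: filterS2 h1 h2 => x e1 e2 e; rewrite /fam_add e1 ?e2.
Qed.

Lemma admissible_opp phi : admissible P T F phi ->
  admissible P T F (fun theta x => - phi theta x).
Proof.
move=> aphi theta sth; split.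
  have [mphi _] := aphi _ sth; have sG := sF_at sth.
  move/(meas_wrtP _ sG) : mphi => mphi; apply/(meas_wrtP _ sG).
  exact: (@measurableT_comp _ _ _ (g_sigma_algebraType (F_at T F theta))).
move=> tau sta; have [_ /(_ _ sta)] := aphi _ sth.
by apply: filterS => x e1 e; rewrite e1.
Qed.

Lemma admissible_limsup (phin : nat -> sfamily) :
  (forall n, admissible P T F (phin n)) -> admissible P T F (fam_limsup phin).
Proof.
move=> aphi theta sth; split.
  apply: meas_wrt_limn_esup; first exact: sF_at.
  by move=> n; have [] := aphi n _ sth.
move=> tau sta.
have /ae_foralln : forall n, {ae P, forall x,
    theta x = tau x -> phin n theta x = phin n tau x}.
  by move=> n; have [_] := aphi n _ sth; exact.
apply: filterS => x e1 e; rewrite /fam_limsup.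
by under eq_fun do rewrite e1//.
Qed.

(** With [A] the event [X j < X i], the time that follows [i] on [A] and [j] elsewhere does at least
    as well as both. *)
Lemma cond_exp_family_directed phi theta (X : sfamily) :
  admissible P T F phi -> stopping theta ->
  (forall tau, after theta tau -> is_cond_exp P (F_at T F theta) (phi tau) (X tau)) ->
  forall i j, after theta i -> after theta j -> exists2 k, after theta k &
    {ae P, forall x, X i x <= X k x /\ X j x <= X k x}.
Proof.
move=> aphi sth XE i j ai aj; have sG := sF_at sth.
have [mXi _ _] := XE _ ai; have [mXj _ _] := XE _ aj.
pose A := [set x | X j x < X i x].
have GA : F_at T F theta A by exact: meas_wrt_lt.
have GAc : F_at T F theta (~` A) by exact: sigma_algebra_setC.
have ak := stopping_after_paste HT HF sth GA ai aj.
exists (paste A i j) => //.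
have mphi tau : after theta tau -> measurable_fun setT (phi tau).
  by move=> [? _]; exact: admissible_measurable.
(* By admissibility [phi tau] and [phi (paste A i j)] agree almost surely on [B], so their
   conditional expectations can be compared there. *)
have le_on B tau : F_at T F theta B -> after theta tau ->
    (forall x, B x -> tau x = paste A i j x) ->
    {ae P, forall x, B x -> X tau x <= X (paste A i j) x}.
  move=> GB ata Be.
  apply: (cond_exp_le_on sG sG _ _ GB _ (mphi _ ata) (mphi _ ak) _
    (XE _ ata) (XE _ ak)) => //; do ?exact: F_atm.
  have [_ /(_ _ ak.1)] := aphi _ ata.1.
  by apply: filterS => x /[swap] Bx ->//; exact: Be.
have iA := le_on A i GA ai.
have jA := le_on (~` A) j GAc aj.
apply: filterS2 (iA _) (jA _).
- move=> x iAx jAx; case: (pselect (A x)) => Ax.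
    by split; [exact: iAx|exact: le_trans (ltW Ax) (iAx Ax)].
  split; last exact: jAx.
  by apply: le_trans (jAx Ax); rewrite leNgt; apply/negP.
- by move=> x Ax; rewrite /paste mem_set.
- by move=> x Ax; rewrite /paste memNset.
Qed.

Lemma snell_sequence phi theta (X : sfamily) Y :
  admissible P T F phi -> stopping theta ->
  (forall tau, after theta tau -> is_cond_exp P (F_at T F theta) (phi tau) (X tau)) ->
  is_ess_sup P (after theta) X Y ->
  exists s : nat -> Omega -> R, [/\ forall n, after theta (s n),
    forall n, {ae P, forall x, X (s n) x <= X (s n.+1) x} &
    {ae P, forall x, Y x = limn_esup (fun n => X (s n) x)}].
Proof.
move=> aphi sth XE YE; apply: (ess_sup_directed _ _ _ YE).
- by exists (fun _ => T); exact: stopping_after_cstT.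
- by move=> tau /XE[+ _ _]; exact: meas_wrt_measurable.
- exact: cond_exp_family_directed XE.
Qed.

(** An essential supremum is by definition measurable only for the full sigma-algebra. Here it is
    almost surely a limit of [F_theta]-measurable variables, and [F_theta] contains the exceptional
    null set. *)
Lemma snell_meas_wrt phi psi theta : admissible P T F phi ->
  is_snell P T F phi psi -> stopping theta ->
  meas_wrt (F_at T F theta) (psi theta).
Proof.
move=> aphi Hpsi sth; have [X [XE YE]] := Hpsi _ sth.
have [s [as_ _ Ys]] := snell_sequence aphi sth XE YE.
apply: (@meas_wrt_ae_eq _ _ _ P T F HT HF theta
  (fun x => limn_esup (fun n => X (s n) x))) => //.
  by apply: filterS Ys.
apply: meas_wrt_limn_esup; first exact: sF_at.
by move=> n; have [] := XE _ (as_ n).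
Qed.

(* On [A = {theta = tau}] the traces of [F_theta] and [F_tau] agree, so a
   stopping time after [theta], sent to [T] off [A], competes for [tau] too. *)
Lemma snell_le_on_eq phi psi theta tau : admissible P T F phi ->
  is_snell P T F phi psi -> stopping theta -> stopping tau ->
  {ae P, forall x, theta x = tau x -> psi theta x <= psi tau x}.
Proof.
move=> aphi Hpsi sth sta; pose A := [set x | theta x = tau x].
have [X1 [X1E [mY1 _ Y1min]]] := Hpsi _ sth.
have [X2 [X2E [mY2 Y2ub _]]] := Hpsi _ sta.
have GA : F_at T F theta A by exact: (F_at_eq HT HF).
have mA := F_atm GA.
(* The value [+oo] off [A] turns the inequality on [A] into a global upper bound, to which
   minimality of [psi theta] applies. *)
pose Z x := if x \in A then psi tau x else +oo.
have mZ : measurable_fun setT Z.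
  apply: (@meas_wrt_measurable _ _ _ measurable) => //.
  apply: meas_wrt_if => //; first exact: sigma_algebra_measurable.
  move=> B mB; apply: measurableI => //.
  by rewrite -[X in measurable X]setTI; exact: mY2.
suff : {ae P, forall x, psi theta x <= Z x}.
  by apply: filterS => x + Ax; rewrite /Z mem_set.
apply: Y1min => // s as_.
pose k := paste A s (fun _ => T).
have ak : after theta k.
  by apply: stopping_after_paste => //; exact: stopping_after_cstT.
have ak' : after tau k.
  split; first exact: ak.1.
  apply: filterS as_.2 => x; rewrite /k /paste; case: ifPn => [/set_mem <-//|_ _].
  by case/andP: (sta.1 x).
have : {ae P, forall x, A x -> X1 s x <= X2 k x}.
  apply: (cond_exp_le_on (sF_at sth) (sF_at sta) _ _ GA _ _ _ _
    (X1E _ as_) (X2E _ ak')); do ?exact: F_atm.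
  - move=> B BA; split; first exact: (F_at_trace HT HF sta _ BA).
    by apply: (F_at_trace HT HF sth _ BA) => x.
  - exact: admissible_measurable as_.1.
  - exact: admissible_measurable ak.1.
  - have [_ /(_ _ ak.1)] := aphi _ as_.1.
    by apply: filterS => x + Ax; move=> -> //; rewrite /k /paste mem_set.
apply: filterS2 (Y2ub _ ak') => x kY sk; rewrite /Z.
case: ifPn => [/set_mem Ax|_]; last exact: leey.
exact: le_trans (sk Ax) kY.
Qed.

Lemma snell_admissible phi psi : admissible P T F phi ->
  is_snell P T F phi psi -> admissible P T F psi.
Proof.
move=> aphi Hpsi theta sth; split; first exact: snell_meas_wrt Hpsi sth.
move=> tau sta.
have h1 := snell_le_on_eq aphi Hpsi sth sta.
have h2 := snell_le_on_eq aphi Hpsi sta sth.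
apply: filterS2 h1 h2 => x e1 e2 e.
by apply/eqP; rewrite eq_le e1// e2.
Qed.

(** Along a sequence [s] the conditional payoffs increase to [psi theta]. By the tower property and
    monotone convergence, conditioning [psi theta] on the earlier time gives the limit of
    [X2 (s n)], and each [s n] competes in the envelope at [tau]. *)
Lemma snell_cond_exp_le phi psi theta tau : admissible P T F phi ->
  is_snell P T F phi psi -> stopping theta -> stopping tau ->
  {ae P, forall x, (tau x <= theta x)%R} ->
  exists Y, is_cond_exp P (F_at T F tau) (psi theta) Y /\
            {ae P, forall x, Y x <= psi tau x}.
Proof.
move=> aphi Hpsi sth sta tath.
have [X1 [X1E Y1E]] := Hpsi _ sth.
have [X2 [X2E [_ Y2ub _]]] := Hpsi _ sta.
have [s [as_ Xs Ys]] := snell_sequence aphi sth X1E Y1E.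
have as' n : after tau (s n) by exact: stopping_after_trans tath (as_ n).
exists (fun x => limn_esup (fun n => X2 (s n) x)); split; last first.
  have /ae_foralln := fun n => Y2ub _ (as' n).
  by apply: filterS => x; exact: limn_esup_le.
apply: (cond_exp_limn_esup (sF_at sta) _ _ _ Xs Ys); first exact: F_atm.
- by move=> n; have [+ _ _] := X1E _ (as_ n); exact: meas_wrt_measurable.
- by have [] := Y1E.
- move=> n; apply: cond_exp_tower (X1E _ (as_ n)) (X2E _ (as' n)).
  exact: (F_at_le HT HF).
Qed.

(** All negative parts vanish almost surely, so their essential supremum is 0; the constant time [T]
    serves as an index showing that every upper bound is nonnegative. *)
Lemma nonneg_esssup_neg_integrable phi : fam_le P T F fam_zero phi ->
  esssup_neg_integrable P T F phi.
Proof.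
move=> phi0; exists (cst 0); split; last by rewrite integral_cst// mul0e.
split => //.
  move=> theta /phi0; apply: filterS => x; rewrite /fam_zero => h.
  by rewrite funenegE ge_max lexx andbT oppe_le0.
move=> Z _ /(_ _ (is_stopping_cstT HT HF)); apply: filterS => x.
exact: le_trans (funeneg_ge0 _ _).
Qed.

Lemma snell_supermartingale phi psi : admissible P T F phi ->
  is_snell P T F phi psi -> fam_le P T F fam_zero psi ->
  supermartingale_family P T F psi.
Proof.
move=> aphi Hpsi psi0; split; first exact: snell_admissible Hpsi.
  exact: nonneg_esssup_neg_integrable.
by move=> theta tau sth sta tath; exact: snell_cond_exp_le Hpsi sth sta tath.
Qed.

Lemma snell_le phi1 phi2 psi1 psi2 :
  admissible P T F phi1 -> admissible P T F phi2 -> fam_le P T F phi1 phi2 ->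
  is_snell P T F phi1 psi1 -> is_snell P T F phi2 psi2 ->
  fam_le P T F psi1 psi2.
Proof.
move=> a1 a2 phi12 H1 H2 theta sth.
have [X1 [X1E [_ _ Y1min]]] := H1 _ sth.
have [X2 [X2E [mY2 Y2ub _]]] := H2 _ sth.
apply: Y1min => // tau ata.
have X12 : {ae P, forall x, X1 tau x <= X2 tau x}.
  apply: (cond_exp_le (sF_at sth) _ _ _ (phi12 _ ata.1) (X1E _ ata) (X2E _ ata)).
  - exact: F_atm.
  - exact: admissible_measurable ata.1.
  - exact: admissible_measurable ata.1.
by apply: filterS2 X12 (Y2ub _ ata) => x; exact: le_trans.
Qed.

Lemma snell_le_supermartingale phi psi H : admissible P T F phi ->
  is_snell P T F phi psi -> supermartingale_family P T F H ->
  fam_le P T F phi H -> fam_le P T F psi H.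
Proof.
move=> aphi Hpsi [aH _ superH] phiH theta sth.
have [X [XE [_ _ Ymin]]] := Hpsi _ sth.
apply: Ymin; first exact: admissible_measurable.
move=> tau ata; have [Y [YE YH]] := superH _ _ ata.1 sth ata.2.
have XY : {ae P, forall x, X tau x <= Y x}.
  apply: (cond_exp_le (sF_at sth) _ _ _ (phiH _ ata.1) (XE _ ata) YE).
  - exact: F_atm.
  - exact: admissible_measurable ata.1.
  - exact: admissible_measurable ata.1.
by apply: filterS2 XY YH => x; exact: le_trans.
Qed.

(** The constant time [T] competes at every [theta], and its conditional payoff is at least the
    conditional expectation of 0. *)
Lemma snell_ge0 phi psi : admissible P T F phi -> is_snell P T F phi psi ->
  {ae P, forall x, 0 <= phi (fun _ => T) x} -> fam_le P T F fam_zero psi.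
Proof.
move=> aphi Hpsi phiT theta sth.
have [X [XE [_ Yub _]]] := Hpsi _ sth.
have aT := stopping_after_cstT HT HF sth.
have zE : is_cond_exp P (F_at T F theta) (cst 0) (cst 0).
  split => //; first exact: meas_wrt_cst (sF_at sth).
  rewrite (eq_integral (cst 0)) ?integral_cst ?mul0e// => x _.
  by rewrite funenegE oppe0 maxxx.
have X0 : {ae P, forall x, 0 <= X (fun _ => T) x}.
  apply: (cond_exp_le (sF_at sth) (@F_atm theta) _ _ _ zE (XE _ aT)) => //.
  exact: admissible_measurable aT.1.
by apply: filterS2 X0 (Yub _ aT) => x; exact: le_trans.
Qed.

(** Two suprema are interchanged, one over [n] and one over stopping times. Conditional monotone
    convergence gives the conditional expectations of [phi] as limits over [n]; an upper bound of
    these limits bounds every level [n], hence every [psin n theta]. *)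
Lemma snell_limsup (phin psin : nat -> sfamily) phi :
  (forall n, admissible P T F (phin n)) -> admissible P T F phi ->
  (forall n, fam_le P T F (phin n) (phin n.+1)) ->
  (forall tau, stopping tau ->
    {ae P, forall x, phi tau x = fam_limsup phin tau x}) ->
  (forall n, is_snell P T F (phin n) (psin n)) ->
  is_snell P T F phi (fam_limsup psin).
Proof.
move=> an aphi phiS phiE Hn theta sth; have sG := sF_at sth.
have /choice[X XE] n := Hn n _ sth.
have X1 n := (XE n).1; have X2 n := (XE n).2.
have psiS n : {ae P, forall x, psin n theta x <= psin n.+1 theta x}.
  exact: (snell_le (an n) (an n.+1) (phiS n) (Hn n) (Hn n.+1)).
exists (fun tau x => limn_esup (fun n => X n tau x)); split.
  move=> tau ata.
  apply: (@cond_exp_limn_esup _ _ _ P (F_at T F theta) (phi tau)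
    (fun n => phin n tau) (fun n => X n tau) sG (@F_atm theta)) => //.
  - by move=> n; exact: admissible_measurable ata.1.
  - exact: admissible_measurable ata.1.
  - by move=> n; exact: phiS ata.1.
  - exact: phiE ata.1.
  - by move=> n; exact: X1.
have XS n tau : after theta tau -> {ae P, forall x, X n tau x <= X n.+1 tau x}.
  move=> ata; apply: (cond_exp_le sG _ _ _ (phiS n _ ata.1) (X1 n _ ata)
    (X1 n.+1 _ ata)).
  - exact: F_atm.
  - exact: admissible_measurable ata.1.
  - exact: admissible_measurable ata.1.
split.
- by apply: measurable_fun_limn_esup => n; have [] := X2 n.
- move=> tau ata.
  have Xpsi n : {ae P, forall x, X n tau x <= psin n theta x}.
    by have [_ + _] := X2 n; exact.
  apply: filterS2 (ae_foralln Xpsi) (ae_foralln psiS) => x xX xS.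
  apply: limn_esup_le => n; apply: le_trans (xX n) _.
  exact: (nondecreasing_le_limn_esup n xS).
- move=> Z mZ XZ.
  have /ae_foralln : forall n, {ae P, forall x, psin n theta x <= Z x}.
    move=> n; have [_ _] := X2 n; apply=> // tau ata.
    have /ae_foralln XSt := fun n => XS n _ ata.
    apply: filterS2 XSt (XZ _ ata) => x xS; apply: le_trans.
    exact: (nondecreasing_le_limn_esup n xS).
  by apply: filterS => x; exact: limn_esup_le.
Qed.

End snell_envelope.

(** * Monotone iteration of two coupled envelopes *)

Section coupled_snell_envelopes.
Local Open Scope ereal_scope.
Context {R : realType} {d : measure_display} {Omega : measurableType d}.
Variables (P : probability Omega R) (T : R) (F : R -> set (set Omega)).
Hypotheses (HT : (0 < T)%R) (HF : usual_filtration P T F).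
Variables xi eta : @sfamily R d Omega.
Hypotheses (axi : admissible P T F xi) (aeta : admissible P T F eta).
Hypotheses (xiT : {ae P, forall x, xi (fun _ => T) x = 0})
           (etaT : {ae P, forall x, eta (fun _ => T) x = 0}).
Variables a b : nat -> @sfamily R d Omega.
Hypotheses (a0 : a 0%N = fam_zero) (b0 : b 0%N = fam_zero).
Hypotheses (aS : forall n, is_snell P T F (fam_add (b n) xi) (a n.+1))
           (bS : forall n, is_snell P T F (fam_add (a n) eta) (b n.+1)).

Lemma iterates_admissible n :
  admissible P T F (a n) /\ admissible P T F (b n).
Proof.
elim: n => [|n [an bn]]; first by rewrite a0 b0; split; exact: admissible_zero.
split; first by apply: snell_admissible (aS n) => //; exact: admissible_add.
by apply: snell_admissible (bS n) => //; exact: admissible_add.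
Qed.

Lemma iterates_nondecreasing n :
  fam_le P T F (a n) (a n.+1) /\ fam_le P T F (b n) (b n.+1).
Proof.
elim: n => [|n [an bn]].
  rewrite {1}a0 {1}b0; split.
    apply: snell_ge0 (aS 0%N) _ => //.
      by apply: admissible_add => //; exact: (iterates_admissible 0).2.
    by apply: filterS xiT => x e; rewrite /fam_add b0 e adde0.
  apply: snell_ge0 (bS 0%N) _ => //.
    by apply: admissible_add => //; exact: (iterates_admissible 0).1.
  by apply: filterS etaT => x e; rewrite /fam_add a0 e adde0.
split.
  apply: snell_le (aS n) (aS n.+1) => //; last exact: fam_add_le.
    by apply: admissible_add => //; exact: (iterates_admissible n).2.
  by apply: admissible_add => //; exact: (iterates_admissible n.+1).2.
apply: snell_le (bS n) (bS n.+1) => //; last exact: fam_add_le.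
  by apply: admissible_add => //; exact: (iterates_admissible n).1.
by apply: admissible_add => //; exact: (iterates_admissible n.+1).1.
Qed.

(** Stated for [b] only, like the two results that follow: exchanging [(a, xi)] with [(b, eta)]
    preserves the hypotheses of the section and yields the counterpart. *)
Lemma iterates_ge0 n : fam_le P T F fam_zero (b n).
Proof.
elim: n => [|n IHn]; first by rewrite b0 => theta _; exact: aeW.
exact: fam_le_trans IHn (iterates_nondecreasing n).2.
Qed.

Lemma fam_limsup_ge0 : fam_le P T F fam_zero (fam_limsup b).
Proof.
move=> theta sth.
have /ae_foralln bge0 := fun n => iterates_ge0 n sth.
have /ae_foralln bnd := fun n => (iterates_nondecreasing n).2 _ sth.
apply: filterS2 bge0 bnd => x x0 xS; apply: le_trans (x0 0%N) _.
exact: (nondecreasing_le_limn_esup 0%N xS).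
Qed.

Lemma fam_limsup_snell : is_snell P T F (fam_add (fam_limsup b) xi) (fam_limsup a).
Proof.
(* Index 0 is dropped because [a n.+1], not [a n], is the envelope built from [b n]. *)
have -> : fam_limsup a = fam_limsup (fun n => a n.+1).
  apply/funext => theta; apply/funext => x.
  by rewrite /fam_limsup -(limn_esup_shiftS (fun n => a n theta x)).
have abxi n : admissible P T F (fam_add (b n) xi).
  by apply: admissible_add => //; exact: (iterates_admissible n).2.
apply: (@snell_limsup _ _ _ _ _ _ HT HF (fun n => fam_add (b n) xi)) => //.
- apply: admissible_add => //; apply: admissible_limsup => // n.
  exact: (iterates_admissible n).2.
- by move=> n; apply: fam_add_le; exact: (iterates_nondecreasing n).2.
- move=> tau sta.
  have /ae_foralln bge0 := fun n => iterates_ge0 n sta.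
  have /ae_foralln bnd := fun n => (iterates_nondecreasing n).2 _ sta.
  apply: filterS2 bge0 bnd => x x0 xS.
  (* The sequence [b] is nonnegative and nondecreasing at [x], so adding [xi], even an infinite
     value, commutes with the limit. *)
  by rewrite /fam_add /fam_limsup limn_esup_nondecreasingD.
Qed.

Lemma iterates_le_supermartingale (H H' : @sfamily R d Omega) n :
  supermartingale_family P T F H -> fam_le P T F fam_zero H ->
  supermartingale_family P T F H' -> fam_le P T F fam_zero H' ->
  fam_le P T F (fam_add H' xi) H -> fam_le P T F (fam_add H eta) H' ->
  fam_le P T F (a n) H /\ fam_le P T F (b n) H'.
Proof.
move=> sH H0 sH' H'0 HH' H'H.
(* At index 0 the bounds are the nonnegativity of [H] and [H']. *)
elim: n => [|n [aH bH']]; first by rewrite a0 b0.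
have [aan abn] := iterates_admissible n.
split.
  apply: (snell_le_supermartingale _ _ _ (aS n)) => //.
    exact: admissible_add.
  exact: fam_le_trans (fam_add_le xi bH') HH'.
apply: (snell_le_supermartingale _ _ _ (bS n)) => //.
  exact: admissible_add.
exact: fam_le_trans (fam_add_le eta aH) H'H.
Qed.

End coupled_snell_envelopes.

Theorem theorem2p3 (R : realType) (d : measure_display) (Omega : measurableType d)
  (P : probability Omega R) (T : R) (F : R -> set (set Omega))
  (HT : 0 < T) (HF : usual_filtration P T F)
  (xi zeta : (Omega -> R) -> Omega -> \bar R)
  (Hxi : admissible P T F xi) (Hzeta : admissible P T F zeta)
  (Hxi_neg : esssup_neg_integrable P T F xi)
  (Hzeta_pos : esssup_pos_integrable P T F zeta)
  (HxiT : {ae P, forall x, xi (fun _ => T) x = 0%E})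
  (HzetaT : {ae P, forall x, zeta (fun _ => T) x = 0%E})
  (Jn J'n : nat -> (Omega -> R) -> Omega -> \bar R)
  (HJ0 : Jn 0%N = fam_zero) (HJ'0 : J'n 0%N = fam_zero)
  (HJS : forall n, is_snell P T F (fam_add (J'n n) xi) (Jn n.+1))
  (HJ'S : forall n, is_snell P T F (fam_sub (Jn n) zeta) (J'n n.+1)) :
  let J := fam_limsup Jn in
  let J' := fam_limsup J'n in
  [/\ fam_le P T F fam_zero J /\ supermartingale_family P T F J,
      fam_le P T F fam_zero J' /\ supermartingale_family P T F J',
      is_snell P T F (fam_add J' xi) J,
      is_snell P T F (fam_sub J zeta) J' &
      forall H H' : (Omega -> R) -> Omega -> \bar R,
        supermartingale_family P T F H -> fam_le P T F fam_zero H ->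
        supermartingale_family P T F H' -> fam_le P T F fam_zero H' ->
        fam_le P T F (fam_add H' xi) H -> fam_le P T F (fam_sub H zeta) H' ->
        fam_le P T F J H /\ fam_le P T F J' H'].
Proof.
move=> J J'.
(* Subtracting [zeta] unfolds to adding [eta], which gives the two recursions the same form and lets
   their roles be exchanged. *)
pose eta theta x := (- zeta theta x)%E.
have aeta : admissible P T F eta by exact: admissible_opp.
have etaT : {ae P, forall x, eta (fun _ => T) x = 0%E}.
  by apply: filterS HzetaT => x; rewrite /eta => ->; rewrite oppe0.
have adm := iterates_admissible HT HF Hxi aeta HJ0 HJ'0 HJS HJ'S.
have aJ : admissible P T F J.
  by apply: admissible_limsup => // n; exact: (adm n).1.
have aJ' : admissible P T F J'.
  by apply: admissible_limsup => // n; exact: (adm n).2.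
have J'0 : fam_le P T F fam_zero J'.
  exact: (fam_limsup_ge0 HT HF Hxi aeta HxiT etaT HJ0 HJ'0 HJS HJ'S).
have J0 : fam_le P T F fam_zero J.
  exact: (fam_limsup_ge0 HT HF aeta Hxi etaT HxiT HJ'0 HJ0 HJ'S HJS).
have sJ : is_snell P T F (fam_add J' xi) J.
  exact: (fam_limsup_snell HT HF Hxi aeta HxiT etaT HJ0 HJ'0 HJS HJ'S).
have sJ' : is_snell P T F (fam_add J eta) J'.
  exact: (fam_limsup_snell HT HF aeta Hxi etaT HxiT HJ'0 HJ0 HJ'S HJS).
split => //.
- by split => //; apply: snell_supermartingale sJ _ => //; exact: admissible_add.
- by split => //; apply: snell_supermartingale sJ' _ => //; exact: admissible_add.
- move=> H H' sH H0 sH' H'0 HH' H'H.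
  have le_n n := iterates_le_supermartingale HT HF Hxi aeta HJ0 HJ'0 HJS HJ'S
    n sH H0 sH' H'0 HH' H'H.
  split => theta sth.
    have /ae_foralln := fun n => (le_n n).1 _ sth.
    by apply: filterS => x; exact: limn_esup_le.
  have /ae_foralln := fun n => (le_n n).2 _ sth.
  by apply: filterS => x; exact: limn_esup_le.
Qed.
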